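(* The following two statements are equivalent: (i) there is a positive constant $C$ such that for every real number $x > C$ the open interval $(x, x + \sqrt{x})$ contains a prime number; (ii) there is a positive integer $N$ such that for every integer $n > N$ the open interval $(p_n, p_n + \sqrt{p_n})$ contains a prime number.
   Context: $p_1 = 2 < p_2 = 3 < p_3 < \cdots$ denotes the increasing enumeration of all prime numbers, so $p_n$ is the $n$-th prime. *)

(* Defs.v *)
From mathcomp Require Import all_boot.

Set Implicit Arguments.
Unset Strict Implicit.
Unset Printing Implicit Defensive.

Fact prime_above_ex (m : nat) : exists p, (m < p) && prime p.
Proof. by have [p ltmp pr_p] := prime_above m; exists p; rewrite ltmp. Qed.

Definition next_prime (m : nat) : nat := ex_minn (prime_above_ex m).

(* Indexed from 1 (nth_prime 1 = 2, nth_prime 2 = 3); nth_prime 0 = 0 is not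
   a prime and only serves to start the iteration. *)
Definition nth_prime (n : nat) : nat := iter n next_prime 0.

Lemma nth_prime_prime n : 0 < n -> prime (nth_prime n).
Proof.
case: n => // n _; rewrite /nth_prime /= /next_prime.
by case: ex_minnP => p /andP[].
Qed.

Lemma nth_prime_ltS n : nth_prime n < nth_prime n.+1.
Proof.
by rewrite {2}/nth_prime /= /next_prime; case: ex_minnP => p /andP[].
Qed.

Lemma nth_prime_surj q : prime q -> exists2 n, 0 < n & nth_prime n = q.
Proof.
move=> pr_q; have le_id n : n <= nth_prime n.
  by elim: n => // n IHn; apply: leq_ltn_trans IHn (nth_prime_ltS n).
have exn : exists n, q <= nth_prime n by exists q.
case: (ex_minnP exn) => -[|n] le_q min_n.
  by move: le_q; rewrite leqNgt prime_gt0.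
exists n.+1 => //; apply/eqP; rewrite eqn_leq le_q andbT.
have lt_q : nth_prime n < q.
  by rewrite ltnNge; apply/negP => /min_n; rewrite ltnn.
rewrite {1}/nth_prime /= /next_prime; case: ex_minnP => p _; apply.
by rewrite lt_q.
Qed.

Example nth_prime1 : nth_prime 1 = 2.
Proof.
rewrite /nth_prime /= /next_prime; case: ex_minnP => p /andP[_ /prime_gt1 p_gt1].
by move/(_ 2 isT) => p_le2; apply/eqP; rewrite eqn_leq p_le2.
Qed.

(* Main.v *)
(* A prime in (p_n, p_n + sqrt p_n) is at least p_(n+1), so if
   p_n <= x < p_(n+1) then it exceeds x, and it lies below x + sqrt x by
   monotonicity of the square root. The converse holds because p_n >= n is
   unbounded. *)
Require Import Defs.
From mathcomp Require Import all_boot all_order all_algebra.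
From mathcomp Require Import reals.

Set Implicit Arguments.
Unset Strict Implicit.
Unset Printing Implicit Defensive.

Import Order.TTheory GRing.Theory Num.Theory.
Local Open Scope ring_scope.

Lemma homo_ltn_infl (u : nat -> nat) n :
  {homo u : i j / (i < j)%N} -> (n <= u n)%N.
Proof.
by move=> u_homo; elim: n => // n IHn; apply: leq_ltn_trans IHn (u_homo _ _ _).
Qed.

Lemma homo_ltn_bracket (R : archiNumDomainType) (u : nat -> nat) (x : R) :
  {homo u : m n / (m < n)%N} -> (u 0)%:R <= x ->
  exists n, (u n)%:R <= x < (u n.+1)%:R.
Proof.
move=> u_homo le_u0x; have x_ge0 : 0 <= x := le_trans (ler0n _ _) le_u0x.
have ex_le : exists n, (u n <= Num.truncn x)%N.
  by exists 0; rewrite truncn_ge_nat.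
have le_truncn n : (u n <= Num.truncn x)%N -> (n <= Num.truncn x)%N.
  exact/leq_trans/homo_ltn_infl.
case: (ex_maxnP ex_le le_truncn) => n le_unx max_n; exists n.
rewrite -truncn_ge_nat // le_unx -truncn_lt_nat // ltnNge.
by apply/negP => /max_n; rewrite ltnn.
Qed.

Lemma homo_ltn_nth_prime : {homo nth_prime : m n / (m < n)%N}.
Proof. exact: homo_ltn ltn_trans nth_prime_ltS. Qed.

Lemma leq_nth_prime : {mono nth_prime : m n / (m <= n)%N}.
Proof. exact: leq_mono homo_ltn_nth_prime. Qed.

Lemma ltn_nth_prime : {mono nth_prime : m n / (m < n)%N}.
Proof. exact: leqW_mono leq_nth_prime. Qed.

Lemma nth_primeS_leq n q :
  prime q -> (nth_prime n < q)%N -> (nth_prime n.+1 <= q)%N.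
Proof.
by move=> /nth_prime_surj[m _ <-]; rewrite ltn_nth_prime leq_nth_prime.
Qed.

Lemma truncn_lt_nth_prime (R : archiRealDomainType) (x : R) n :
  (Num.truncn x < n)%N -> x < (nth_prime n)%:R.
Proof.
move=> lt_xn; apply: lt_le_trans (truncnS_gt x) _.
by rewrite ler_nat (leq_trans lt_xn) ?(homo_ltn_infl _ homo_ltn_nth_prime).
Qed.

Definition has_prime (R : numDomainType) (I : interval R) : Prop :=
  exists q : nat, prime q /\ q%:R \in I.

Lemma has_prime_gap (R : numDomainType) n (a b c : R) :
  a < (nth_prime n.+1)%:R -> b <= c ->
  has_prime `](nth_prime n)%:R, b[ -> has_prime `]a, c[.
Proof.
move=> lt_ap le_bc [q [pr_q]]; rewrite in_itv /= ltr_nat => /andP[lt_pq lt_qb].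
exists q; split=> //; rewrite in_itv /= (lt_le_trans lt_qb) // andbT.
by rewrite (lt_le_trans lt_ap) // ler_nat nth_primeS_leq.
Qed.

Lemma has_prime_from_nth_prime (R : archiNumDomainType) (f : R -> R) N :
  {homo f : x y / x <= y} ->
  (forall n, (N < n)%N ->
     has_prime `](nth_prime n)%:R, f (nth_prime n)%:R[) ->
  forall x, (nth_prime N.+1)%:R <= x -> has_prime `]x, f x[.
Proof.
move=> f_homo prime_gtN x le_px.
have le_p0x : (nth_prime 0)%:R <= x.
  by apply: le_trans le_px; rewrite ler_nat leq_nth_prime.
have [n /andP[le_pnx lt_xpn]] := homo_ltn_bracket homo_ltn_nth_prime le_p0x.
have lt_Nn : (N < n)%N.
  by rewrite -ltnS -ltn_nth_prime -(ltr_nat R) (le_lt_trans le_px).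
exact: has_prime_gap lt_xpn (f_homo _ _ le_pnx) (prime_gtN n lt_Nn).
Qed.

Theorem theorem11 (R : realType) :
  (exists C : R, 0 < C /\
     forall x : R, C < x ->
       exists q : nat, prime q /\ q%:R \in `]x, x + Num.sqrt x[)
  <->
  (exists N : nat, (0 < N)%N /\
     forall n : nat, (N < n)%N ->
       exists q : nat, prime q /\
         q%:R \in `]((nth_prime n)%:R : R),
                    (nth_prime n)%:R + Num.sqrt (nth_prime n)%:R[).
Proof.
split=> [[C [_ prime_gtC]] | [N [_ prime_gtN]]].
  exists (Num.truncn C).+1; split=> // n /ltnW lt_Cn.
  exact/prime_gtC/truncn_lt_nth_prime.
exists (nth_prime N.+1)%:R; split=> [|x /ltW le_px].
  by rewrite ltr0n prime_gt0 ?nth_prime_prime.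
have shift_homo : {homo (fun y : R => y + Num.sqrt y) : y z / y <= z}.
  by move=> y z le_yz; rewrite lerD ?ler_wsqrtr.
exact: has_prime_from_nth_prime shift_homo prime_gtN x le_px.
Qed.
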